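(* Let $\varepsilon\in(0,1)$, let $d_1\neq d_2$ be positive integers, and let $u_1,u_2$ be vertices of $G_1=\mathbb Z^{d_1}$ and $G_2=\mathbb Z^{d_2}$ respectively. Then $(G_1,u_1)$ and $(G_2,u_2)$ are distinguishable by $S^{(2)}$.
   Context: $\mathbb Z^{d}$ denotes the integer lattice graph (two points are adjacent iff their $\ell_1$-distance is $1$). Noisy voter model (NVM) with noise $\varepsilon\in(0,1)$ on a connected (locally finite, with at least two vertices) graph $G$: let $N_G(u)$ be the set of neighbors of $u$. At time $0$, $X_0(u)\sim\mathrm{Bern}(1/2)$ independently over all $u\in V(G)$. For every $t\ge 1$ and $u\in V(G)$, $$X_t(u)=\xi_t(u)Y_t(u)+(1-\xi_t(u))\sum_{v\in N_G(u)}I(\eta_t(u)=v)X_{t-1}(v),$$ where $\xi_t(u)\sim\mathrm{Bern}(\varepsilon)$, $Y_t(u)\sim\mathrm{Bern}(1/2)$, $\eta_t(u)$ is uniform on $N_G(u)$, and all the variables $\xi_t(u),Y_t(u),\eta_t(u)$ ($t\ge1$, $u\in V(G)$) and $X_0(u)$ ($u\in V(G)$) are independent. Write $X_t(G,u)=X_t(u)$. Distinguishability: let $(G_1,u_1),(G_2,u_2)$ be rooted graphs, both running the NVM with the same $\varepsilon$. They are distinguishable by a sequence $S=(S_t)_{t}$, where $S_t$ is a real-valued function of the observations up to time $t$ at a vertex, if there are sets $\mathcal S_1(t),\mathcal S_2(t)\subset\mathbb R$, disjoint for each $t$, such that $$\mathsf P\big[S_t(X_i(G_1,u_1),\,i\le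 t)\in\mathcal S_1(t),\ S_t(X_i(G_2,u_2),\,i\le t)\in\mathcal S_2(t)\big]\to1\quad (t\to\infty).$$ Repetition statistic: for $d\in\mathbb N$ and $t>d$, $S^{(d)}_t=\frac1{t-d}\sum_{i=1}^{t-d}I(X_i(u)=X_{i+d}(u))$, where $u$ is the observed vertex, and $S^{(d)}=(S^{(d)}_t)_t$. *)

(* Defs.v *)
From HB Require Import structures.
From mathcomp Require Import all_boot all_order all_algebra finmap.
From mathcomp Require Import zify.
From mathcomp Require Import all_classical all_reals all_analysis.
Import Order.TTheory GRing.Theory Num.Theory.
Import numFieldNormedType.Exports.

Set Implicit Arguments.
Unset Strict Implicit.
Unset Printing Implicit Defensive.

Local Open Scope classical_set_scope.
Local Open Scope ring_scope.

Record graph := Graph {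
  vertex :> choiceType;
  adj : rel vertex;
  adj_sym : symmetric adj;
  adj_irr : irreflexive adj;
  adj_locally_finite : forall u, finite_set [set v | adj u v];
  adj_connected : forall u v, exists2 p, path adj u p & v = last u p;
  vertex_nontrivial : exists u v : vertex, u != v }.

Definition neighbors (G : graph) (u : G) : {fset G} :=
  fset_set [set v | adj u v].

Lemma in_neighbors (G : graph) (u v : G) : (v \in neighbors u) = adj u v.
Proof.
rewrite in_fset_set; last exact: adj_locally_finite.
by apply/idP/idP; rewrite inE.
Qed.

Definition degree (G : graph) (u : G) : nat := #|` neighbors u|%fset.

Section Lattice.
Variable d : nat.
Implicit Types u v w : 'rV[int]_d.

Definition dist1 u v : int := \sum_(i < d) `|u 0 i - v 0 i|.

Definition lattice_adj u v : bool := dist1 u v == 1.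

Lemma dist1_ge0 u v : 0 <= dist1 u v.
Proof. by rewrite /dist1 sumr_ge0. Qed.

Lemma lattice_adj_sym : symmetric lattice_adj.
Proof.
move=> u v; rewrite /lattice_adj; congr (_ == _).
by apply: eq_bigr => i _; rewrite distrC.
Qed.

Lemma lattice_adj_irr : irreflexive lattice_adj.
Proof.
by move=> u; rewrite /lattice_adj /dist1 big1// => i _; rewrite subrr normr0.
Qed.

Lemma dist1_step u v (i : 'I_d) : u 0 i != v 0 i ->
  let w := u + Num.sg (v 0 i - u 0 i) *: delta_mx 0 i in
  lattice_adj u w /\ dist1 u v = dist1 w v + 1.
Proof.
move=> uv w; set s := Num.sg (v 0 i - u 0 i).
have wE j : w 0 j = u 0 j + s * (j == i)%:R by rewrite !mxE eqxx.
have s1 : `|s| = 1 by rewrite normr_sg subr_eq0 eq_sym uv.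
split.
  rewrite /lattice_adj /dist1 (bigD1 i)//= big1 => [|j /negPf ji].
    by rewrite wE eqxx mulr1 opprD addNKr normrN s1 addr0.
  by rewrite wE ji mulr0 addr0 subrr normr0.
rewrite /dist1 (bigD1 i)//= [in RHS](bigD1 i)//= addrAC; congr (_ + _).
  rewrite wE eqxx mulr1 /s; move: uv; case: ltgtP => // uv _.
    by rewrite gtr0_sg ?subr_gt0//; lia.
  by rewrite ltr0_sg ?subr_lt0//; lia.
by apply: eq_bigr => j /negPf ji; rewrite wE ji mulr0 addr0.
Qed.

Lemma lattice_adj_connected u v :
  exists2 p, path lattice_adj u p & v = last u p.
Proof.
have [n] : exists n : nat, dist1 u v = n%:Z.
  by exists `|dist1 u v|%N; rewrite gez0_abs// dist1_ge0.
elim: n u => [|n IHn] u uvn.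
  exists [::] => //=; apply/rowP => i; move/eqP: uvn.
  rewrite psumr_eq0// => /allP/(_ i (mem_index_enum _)) /=.
  by rewrite normr_eq0 subr_eq0 => /eqP.
have [i ui] : exists i, u 0 i != v 0 i.
  apply/existsP; apply: contra_eqT uvn => /existsPn uv.
  by rewrite /dist1 big1// => i _; rewrite (eqP (negbNE (uv i))) subrr normr0.
have [] := dist1_step ui; set w := u + _ => uw.
rewrite uvn -addn1 PoszD => /addIr/esym/IHn[p wp vp].
by exists (w :: p) => //=; rewrite uw.
Qed.

Lemma lattice_adj_locally_finite u : finite_set [set v | lattice_adj u v].
Proof.
pose f (x : 'I_d * bool) := u + (-1) ^+ x.2 *: delta_mx 0 x.1.
apply: (sub_finite_set (B := f @` setT)); last exact/finite_image/finite_finset.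
move=> v /= uv.
have [i ui] : exists i, u 0 i != v 0 i.
  apply/existsP; apply: contraTT uv => /existsPn uv.
  rewrite /lattice_adj /dist1 big1// => i _.
  by rewrite (eqP (negbNE (uv i))) subrr normr0.
have [_] := dist1_step ui; move: uv; rewrite {1}/lattice_adj => /eqP ->.
rewrite -{1}[1]add0r => /addIr/esym/eqP; rewrite psumr_eq0// => /allP wv.
exists (i, v 0 i - u 0 i < 0) => //; rewrite /f /=.
rewrite -[(-1) ^+ _](_ : Num.sg (v 0 i - u 0 i) = _); last first.
  by rewrite sgr_def subr_eq0 eq_sym ui mulr1n.
apply/rowP => j; have /= := wv j (mem_index_enum _).
by rewrite normr_eq0 subr_eq0 => /eqP.
Qed.

Lemma lattice_nontrivial : (0 < d)%N -> exists u v : 'rV[int]_d, u != v.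
Proof.
move=> d0; exists 0, (const_mx 1); apply/eqP => /rowP/(_ (Ordinal d0)).
by rewrite !mxE.
Qed.

End Lattice.

Definition lattice (d : nat) (d_gt0 : (0 < d)%N) : graph :=
  Graph (@lattice_adj_sym d) (@lattice_adj_irr d)
    (@lattice_adj_locally_finite d) (@lattice_adj_connected d)
    (lattice_nontrivial d_gt0).

(* The sigma-algebra generated by [Z], the codomain being discrete. *)
Definition generated_by (T E : Type) (Z : T -> E) : set (set T) :=
  [set Z @^-1` B | B in [set: set E]].

Definition mutually_independent d (T : measurableType d) (R : realType)
    (P : probability T R) (I : choiceType) (F : I -> set (set T)) : Prop :=
  forall (J : {fset I}) (A : I -> set T), (forall i, i \in J -> F i (A i)) ->
    P (\bigcap_(i in [set` J]) A i) = (\prod_(i <- J) P (A i))%E.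

Record nvm d (T : measurableType d) (R : realType) (P : probability T R)
    (eps : R) (G : graph) := NVM {
  nvm_init : G -> {RV P >-> bool};
  (* The values at time 0 of the next three families are unused and are left
     unconstrained. *)
  nvm_noise : nat -> G -> {RV P >-> bool};
  nvm_fresh : nat -> G -> {RV P >-> bool};
  nvm_choice : nat -> G -> T -> G;
  nvm_state : nat -> G -> T -> bool;
  nvm_choice_measurable : forall t u (B : set G),
    measurable (nvm_choice t.+1 u @^-1` B);
  nvm_initP : forall u,
    distribution P (nvm_init u) = bernoulli_prob 2^-1 :> (set bool -> \bar R);
  nvm_noiseP : forall t u,
    distribution P (nvm_noise t.+1 u) = bernoulli_prob eps
      :> (set bool -> \bar R);
  nvm_freshP : forall t u,
    distribution P (nvm_fresh t.+1 u) = bernoulli_prob 2^-1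
      :> (set bool -> \bar R);
  nvm_choiceP : forall t u v, v \in neighbors u ->
    P (nvm_choice t.+1 u @^-1` [set v]) = ((degree u)%:R^-1)%:E;
  nvm_independent : mutually_independent P
    (fun i : G + (nat * G + (nat * G + nat * G)) =>
      match i with
      | inl u => generated_by (nvm_init u)
      | inr (inl (t, u)) => generated_by (nvm_noise t.+1 u)
      | inr (inr (inl (t, u))) => generated_by (nvm_fresh t.+1 u)
      | inr (inr (inr (t, u))) => generated_by (nvm_choice t.+1 u)
      end);
  nvm_state0 : forall u w, nvm_state 0 u w = nvm_init u w;
  nvm_stateS : forall t u w,
    (nvm_state t.+1 u w)%:R =
      (nvm_noise t.+1 u w)%:R * (nvm_fresh t.+1 u w)%:R
      + (1 - (nvm_noise t.+1 u w)%:R)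
        * \sum_(v <- neighbors u)
            (nvm_choice t.+1 u w == v)%:R * (nvm_state t v w)%:R :> R }.

Definition observations d (T : measurableType d) (R : realType)
    (P : probability T R) (eps : R) (G : graph) (X : nvm P eps G) (u : G)
    (t : nat) (w : T) : 'I_t.+1 -> bool :=
  fun i => nvm_state X i u w.

(* The law of an NVM is determined by [eps] and the graph, so the separating
   sets are chosen before the realizations. The coupling of the two models is
   arbitrary: it affects neither limit, since the joint probability tends to 1
   iff both marginal probabilities do. *)
Definition distinguishable (R : realType) (eps : R) (G1 : graph) (u1 : G1)
    (G2 : graph) (u2 : G2) (S : forall t : nat, ('I_t.+1 -> bool) -> R) : Prop :=
  exists S1 S2 : nat -> set R,
    (forall t, S1 t `&` S2 t = set0) /\
    forall d (T : measurableType d) (P : probability T R)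
        (X1 : nvm P eps G1) (X2 : nvm P eps G2),
      P [set w | S1 t (S t (observations X1 u1 w)) /\
                 S2 t (S t (observations X2 u2 w))] @[t --> \oo] --> 1%E.

(* Meaningful only for [d < t]. *)
Definition repetition_statistic (R : realType) (d t : nat)
    (x : 'I_t.+1 -> bool) : R :=
  (t - d)%:R^-1 *
  \sum_(1 <= i < (t - d).+1) (x (inord i) == x (inord (i + d)))%:R.

(* Main.v *)
(* Write a spin as +1 or -1 according to the state. Given the past, the spin of
   u at time t+1 has mean (1 - eps) times the average of the spins of its
   neighbors at time t, and distinct vertices are updated independently.
   Iterating this backwards in time (duality with coalescing killed random
   walks) expresses E[X_i(u) X_{i+2}(u)], for spins on Z^d, as the probability
   that a simple random walk surviving each step with probability 1 - eps
   returns to its starting point within 2i + 2 steps. The same recursion,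
   applied to the difference between joint and product expectations, shows that
   the repetitions at distinct times decorrelate exponentially fast, so by
   Chebyshev's inequality S^(2) converges in probability to (1 + r_d)/2, where
   r_d is the return probability of the killed walk.

   It remains to see that r_d is strictly decreasing in d. It is (1 - eps) times
   the average, over the unit vectors e, of the probability of hitting 0 from e.
   For d < d', projecting a walk on Z^d' to d coordinates, one of them along e,
   gives a walk on Z^d which also pays the killing factor for the invisible
   steps, so it hits 0 strictly less often. *)
Require Import Defs.
From mathcomp Require Import all_boot all_order all_algebra finmap perm.
From mathcomp Require Import zify ring lra.
From mathcomp Require Import all_classical all_reals all_analysis.
From mathcomp Require Import measurable_realfun.
Import Order.TTheory GRing.Theory Num.Theory.
Import numFieldNormedType.Exports.

Set Implicit Arguments.
Unset Strict Implicit.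
Unset Printing Implicit Defensive.

Local Open Scope classical_set_scope.
Local Open Scope ring_scope.

(** * Product formulas for events built from disjoint sets of independent sources *)

Section Independence.
Context d (T : measurableType d) (R : realType) (P : probability T R).
Context (I : choiceType) (F : I -> set (set T)).
Hypothesis F_measurable : forall i A, F i A -> measurable A.
Hypothesis F_setT : forall i, F i setT.
Hypothesis F_setI : forall i, setI_closed (F i).
Hypothesis F_indep : mutually_independent P F.

(** These finite intersections form a pi-system generating the sigma-algebra of the sources with
    index in [Q]. *)
Definition cylinder (Q : pred I) : set (set T) :=
  [set C | exists J : {fset I}, exists A : I -> set T,
    [/\ forall i, i \in J -> Q i, forall i, i \in J -> F i (A i) &
        C = \bigcap_(i in [set` J]) A i]].

Lemma cylinder_generator (Q : pred I) i A : Q i -> F i A -> cylinder Q A.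
Proof.
move=> Qi FA; exists [fset i]%fset, (fun=> A); split=> [j|j|].
- by rewrite inE => /eqP ->.
- by rewrite inE => /eqP ->.
- apply/seteqP; split=> [x Ax j _ //|x]; apply => /=; by rewrite inE.
Qed.

Lemma cylinder_measurable Q C : cylinder Q C -> measurable C.
Proof.
move=> [J [A [_ FA ->]]]; rewrite bigcap_fset.
rewrite big_seq; apply: big_ind => //; first exact: measurableI.
by move=> i /FA/F_measurable.
Qed.

Lemma cylinder_setI Q : setI_closed (cylinder Q).
Proof.
move=> _ _ [J [A [QJ FA ->]]] [K [B [QK FB ->]]].
pose A' i := if i \in J then A i else setT.
pose B' i := if i \in K then B i else setT.
exists (J `|` K)%fset, (fun i => A' i `&` B' i); split=> [i|i|].
- by rewrite inE => /orP[/QJ|/QK].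
- move=> _; apply: F_setI; rewrite ?/A' ?/B'.
    by case: (boolP (i \in J)) => [iJ|_]; [exact: FA|exact: F_setT].
  by case: (boolP (i \in K)) => [iK|_]; [exact: FB|exact: F_setT].
- rewrite bigcapI; congr (_ `&` _); apply/seteqP; split=> x xA i /= iJK.
  + by rewrite /A'; case: ifP => // /xA.
  + by have := xA i; rewrite /= inE iJK /A' iJK; apply.
  + by rewrite /B'; case: ifP => // /xA.
  + by have := xA i; rewrite /= inE iJK orbT /B' iJK; apply.
Qed.

(** The index sets of [A] and [B] are disjoint, since one lies in [Q] and the other in its
    complement. The two families therefore merge into one, to which mutual independence applies. *)
Lemma cylinder_indep Q (A B : set T) : cylinder Q A -> cylinder (predC Q) B ->
  P (A `&` B) = (P A * P B)%E.
Proof.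
move=> [J [A' [QJ FA ->]]] [K [B' [QK FB ->]]].
have KJ i : i \in K -> i \in J = false.
  by move=> /QK/=; apply: contraNF => /QJ.
pose D i := if i \in J then A' i else B' i.
have -> : \bigcap_(i in [set` J]) A' i `&` \bigcap_(i in [set` K]) B' i =
    \bigcap_(i in [set` (J `|` K)%fset]) D i.
  apply/seteqP; split=> [x [xA xB] i /=|x xD].
    by rewrite inE /D; case: ifP => [/xA//|_ /xB].
  split=> i /= iJK; have := xD i; rewrite /= inE iJK ?orbT /D ?iJK ?KJ//; exact.
have FD i : i \in (J `|` K)%fset -> F i (D i).
  by rewrite inE /D; case: ifP => [/FA//|_ /FB].
rewrite !F_indep// (perm_big (J ++ K)) /=; last first.
  apply: uniq_perm => [//||i]; last by rewrite inE mem_cat.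
  rewrite cat_uniq !fset_uniq andbT /= -all_predC.
  by apply/allP => i /KJ /= ->.
rewrite big_cat /=; congr (_ * _)%E; apply: eq_big_seq => i iJ; rewrite /D.
- by rewrite iJ.
- by rewrite KJ.
Qed.

(** Uniqueness of measures on a pi-system: for fixed [B], both sides are finite measures in [A] that
    agree on [cylinder Q]. *)
Lemma sigma_cylinder_indep Q (A B : set T) :
  <<s cylinder Q >> A -> cylinder (predC Q) B -> P (A `&` B) = (P A * P B)%E.
Proof.
move=> sA cB; have mB := cylinder_measurable cB.
have PB_ge0 : 0 <= fine (P B) by rewrite fine_ge0.
have PBE : (fine (P B))%:E = P B by rewrite fineK// fin_num_measure.
pose m2 := mscale (NngNum PB_ge0) P.
have -> : (P A * P B)%E = m2 A by rewrite /m2 /mscale /= PBE muleC.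
apply: (@g_sigma_algebra_measure_unique _ _ _ (cylinder Q) _ (fun=> setT) _ _
  (mrestr P mB) m2) => //.
- by move=> C /cylinder_measurable.
- move=> _; exists fset0, (fun=> setT); split=> //.
  by rewrite bigcapT.
- by rewrite bigcup_const.
- exact: cylinder_setI.
- move=> C cC; rewrite /= /mrestr (cylinder_indep cC cB) /m2 /mscale /=.
  by rewrite PBE muleC.
- by move=> _; rewrite /= /mrestr setTI (le_lt_trans (probability_le1 P mB))// ltry.
Qed.

End Independence.

(** * Measurability of the states with respect to the sources of randomness *)

Section NVM.
Context d (T : measurableType d) (R : realType) (P : probability T R).
Context (eps : R) (G : graph) (X : nvm P eps G).

Notation index := (G + (nat * G + (nat * G + nat * G)))%type.

Definition source (i : index) : set (set T) :=
  match i with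
  | inl u => generated_by (nvm_init X u)
  | inr (inl (t, u)) => generated_by (nvm_noise X t.+1 u)
  | inr (inr (inl (t, u))) => generated_by (nvm_fresh X t.+1 u)
  | inr (inr (inr (t, u))) => generated_by (nvm_choice X t.+1 u)
  end.

Lemma generated_by_setT (U E : Type) (Z : U -> E) : generated_by Z setT.
Proof. by exists setT => //; rewrite preimage_setT. Qed.

Lemma generated_by_setI (U E : Type) (Z : U -> E) : setI_closed (generated_by Z).
Proof. by move=> _ _ [A _ <-] [B _ <-]; exists (A `&` B). Qed.

Lemma source_measurable i A : source i A -> measurable A.
Proof.
by case: i => [u|[[t u]|[[t u]|[t u]]]] [B _ <-];
  [exact: measurable_funPTI|exact: measurable_funPTI|exact: measurable_funPTI
  |exact: nvm_choice_measurable].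
Qed.

Lemma source_setT i : source i setT.
Proof. by case: i => [u|[[t u]|[[t u]|[t u]]]]; exact: generated_by_setT. Qed.

Lemma source_setI i : setI_closed (source i).
Proof. by case: i => [u|[[t u]|[[t u]|[t u]]]]; exact: generated_by_setI. Qed.

Lemma source_indep : mutually_independent P source.
Proof. exact: nvm_independent. Qed.

(** Measurability of [z] with respect to the sources in [Q]. Keeping [z] Boolean lets a product of
    spins be written as an iterated [==]. *)
Definition adapted (Q : pred index) (z : T -> bool) :=
  <<s cylinder source Q >> [set w | z w].

Lemma adapted_source (Q : pred index) i (z : T -> bool) :
  Q i -> source i [set w | z w] -> adapted Q z.
Proof. by move=> Qi Fz; apply: sub_sigma_algebra; exact: cylinder_generator Qi Fz. Qed.

Lemma adapted_cst Q b : adapted Q (fun=> b).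
Proof.
rewrite /adapted; case: b => /=.
  rewrite [X in _ X](_ : _ = setT); last by apply/seteqP; split.
  exact: (@measurableT _ (g_sigma_algebraType (cylinder source Q))).
rewrite [X in _ X](_ : _ = set0); last by apply/seteqP; split.
exact: (@measurable0 _ (g_sigma_algebraType (cylinder source Q))).
Qed.

Lemma adapted_and Q z z' : adapted Q z -> adapted Q z' ->
  adapted Q (fun w => z w && z' w).
Proof.
move=> az az'; rewrite /adapted.
rewrite [X in _ X](_ : _ = [set w | z w] `&` [set w | z' w]).
  exact: (@measurableI _ (g_sigma_algebraType (cylinder source Q))).
by apply/seteqP; split=> w /= /andP.
Qed.

Lemma adapted_neg Q z : adapted Q z -> adapted Q (fun w => ~~ z w).
Proof.
move=> az; rewrite /adapted.
rewrite [X in _ X](_ : _ = ~` [set w | z w]).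
  exact: (@measurableC _ (g_sigma_algebraType (cylinder source Q))).
by apply/seteqP; split=> w /= /negP.
Qed.

Lemma adapted_or Q z z' : adapted Q z -> adapted Q z' ->
  adapted Q (fun w => z w || z' w).
Proof.
move=> az az'.
rewrite (_ : (fun w => _) = fun w => ~~ (~~ z w && ~~ z' w)).
  by apply: adapted_neg; apply: adapted_and; exact: adapted_neg.
by apply/funext => w; rewrite -negb_or negbK.
Qed.

Lemma adapted_eq Q z z' : adapted Q z -> adapted Q z' ->
  adapted Q (fun w => z w == z' w).
Proof.
move=> az az'.
rewrite (_ : (fun w => _) = fun w => (z w && z' w) || (~~ z w && ~~ z' w)).
  by apply: adapted_or; apply: adapted_and => //; exact: adapted_neg.
by apply/funext => w; case: (z w); case: (z' w).
Qed.

Lemma adapted_measurable Q z : adapted Q z -> measurable [set w | z w].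
Proof.
rewrite /adapted; apply: smallest_sub; first exact: sigma_algebra_measurable.
by move=> A; apply: cylinder_measurable; exact: source_measurable.
Qed.

(** The choice is a neighbor only almost surely. Where it is not, the sum over the neighbors
    vanishes, so the copied value is [false]. *)
Lemma nvm_state_rec t u w : nvm_state X t.+1 u w =
  if nvm_noise X t.+1 u w then nvm_fresh X t.+1 u w
  else (nvm_choice X t.+1 u w \in neighbors u) &&
       nvm_state X t (nvm_choice X t.+1 u w) w.
Proof.
have Rinj (a b : bool) : a%:R = b%:R :> R -> a = b.
  by move/eqP; rewrite eqr_nat => /eqP; case: a; case: b.
apply: Rinj; rewrite nvm_stateS; case: ifP => _.
  by rewrite subrr mul0r addr0 mul1r.
rewrite mul0r add0r subr0 mul1r; set c := nvm_choice X t.+1 u w.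
have [cN|cN] /= := boolP (c \in neighbors u).
  rewrite (big_rem c)//= eqxx mul1r big_seq big1 ?addr0// => v.
  by rewrite (mem_rem_uniq _ (fset_uniq _)) inE eq_sym => /andP[/negPf -> _];
    rewrite mul0r.
rewrite big_seq big1// => v vN; case: eqP => [cv|]; last by rewrite mul0r.
by move: cN; rewrite cv vN.
Qed.

(** The noise, fresh bit and choice that drive the update of [u] from time [t] to time [t.+1];
    initial values belong to no site. *)
Definition at_site t u (i : index) : bool :=
  match i with
  | inl _ => false
  | inr (inl (s, v)) | inr (inr (inl (s, v))) | inr (inr (inr (s, v))) =>
    (s == t) && (v == u)
  end.

Definition off_site t u (i : index) := ~~ at_site t u i.

(** A state at time at most [t] uses only sources of earlier updates, and another vertex at time
    [t.+1] adds only its own. This makes the update of [u] independent of the past and of the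
    simultaneous updates elsewhere. *)
Lemma adapted_state t u s v : (s <= t)%N || (s == t.+1) && (v != u) ->
  adapted (off_site t u) (nvm_state X s v).
Proof.
elim: s v => [|s IHs] v sv.
  rewrite (_ : nvm_state X 0 v = nvm_init X v).
    apply: (@adapted_source _ (inl v)) => //=.
    by exists [set true].
  by apply/funext => w; rewrite nvm_state0.
have st : (s <= t)%N by case/orP: sv => [|/andP[/eqP[->]]]//; exact: ltnW.
have off : ~~ ((s == t) && (v == u)).
  by apply/negP => /andP[/eqP s_t /eqP vu]; move: sv; rewrite s_t vu ltnn !eqxx.
(* A finite disjunction over the neighbors exhibits the state as a Boolean combination of single
   sources and earlier states. *)
rewrite (_ : nvm_state X s.+1 v = fun w =>
   (nvm_noise X s.+1 v w && nvm_fresh X s.+1 v w) ||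
   (~~ nvm_noise X s.+1 v w &&
    has (fun x => (nvm_choice X s.+1 v w == x) && nvm_state X s x w)
      (neighbors v))); last first.
  apply/funext => w; rewrite nvm_state_rec; case: ifP => //= _; first by rewrite orbF.
  apply/andP/hasP => [[cN cs]|[x xN /andP[/eqP -> xs]]]; last by [].
  by exists (nvm_choice X s.+1 v w); rewrite ?eqxx.
have noiseP : adapted (off_site t u) (nvm_noise X s.+1 v).
  by apply: (@adapted_source _ (inr (inl (s, v)))) => //=; exists [set true].
apply: adapted_or; apply: adapted_and => //.
- by apply: (@adapted_source _ (inr (inr (inl (s, v))))) => //=; exists [set true].
- exact: adapted_neg.
elim: (enum_fset (neighbors v)) => [|x N IHN]; first by rewrite /=; exact: adapted_cst.
rewrite /=; apply: adapted_or => //; apply: adapted_and.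
  apply: (@adapted_source _ (inr (inr (inr (s, v))))) => //=.
  by exists [set x] => //; apply/seteqP; split=> w /= /eqP.
by apply: IHs; rewrite st.
Qed.

End NVM.

(** * Real-valued probabilities and spin expectations of Boolean events *)

Section EventProbability.
Context d (T : measurableType d) (R : realType) (P : probability T R).
Implicit Types z c : T -> bool.

Definition pr z : R := fine (P [set w | z w]).

Definition mevent z := measurable [set w | z w].

Lemma mevent_and z c : mevent z -> mevent c -> mevent (fun w => z w && c w).
Proof.
move=> mz mc; rewrite /mevent [X in measurable X](_ : _ = [set w | z w] `&` [set w | c w]).
  exact: measurableI.
by apply/seteqP; split=> w /= /andP.
Qed.

Lemma mevent_neg z : mevent z -> mevent (fun w => ~~ z w).
Proof.
move=> mz; rewrite /mevent [X in measurable X](_ : _ = ~` [set w | z w]).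
  exact: measurableC.
by apply/seteqP; split=> w /= /negP.
Qed.

Lemma mevent_eq z c : mevent z -> mevent c -> mevent (fun w => z w == c w).
Proof.
move=> mz mc.
rewrite (_ : (fun w => _) = fun w => ~~ (~~ (z w && c w) && ~~ (~~ z w && ~~ c w))).
  by apply/mevent_neg/mevent_and; apply/mevent_neg/mevent_and => //;
    exact: mevent_neg.
by apply/funext => w; case: (z w); case: (c w).
Qed.

Lemma prE z : mevent z -> P [set w | z w] = (pr z)%:E.
Proof. by move=> mz; rewrite fineK// fin_num_measure. Qed.

Lemma pr_ge0 z : 0 <= pr z.
Proof. by rewrite fine_ge0. Qed.

Lemma pr_le1 z : mevent z -> pr z <= 1.
Proof. by move=> mz; rewrite -lee_fin -prE// probability_le1. Qed.

Lemma pr_true : pr (fun=> true) = 1.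
Proof.
by rewrite /pr [X in P X](_ : _ = setT) ?probability_setT//; apply/seteqP; split.
Qed.

Lemma pr_false : pr (fun=> false) = 0.
Proof.
by rewrite /pr [X in P X](_ : _ = set0) ?measure0//; apply/seteqP; split.
Qed.

Lemma pr_split c z : mevent z -> mevent c ->
  pr z = pr (fun w => z w && c w) + pr (fun w => z w && ~~ c w).
Proof.
move=> mz mc; have mn := mevent_neg mc.
apply: EFin_inj; rewrite EFinD -!prE//; [|exact: mevent_and..].
rewrite -measureU//; [|exact: mevent_and..|].
  congr (P _); apply/seteqP; split=> w /=; last by case=> /andP[].
  by move=> ->; case: (c w); [left|right].
by apply/seteqP; split=> // w [/= /andP[_ ->] /andP[]].
Qed.

Lemma pr_le z c : mevent z -> mevent c -> (forall w, z w -> c w) -> pr z <= pr c.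
Proof.
move=> mz mc zc; rewrite -lee_fin -!prE// le_measure ?inE//.
Qed.

Lemma pr_neg z : mevent z -> pr (fun w => ~~ z w) = 1 - pr z.
Proof.
move=> mz; rewrite -pr_true (@pr_split z (fun=> true))//; first by rewrite addrAC subrr add0r.
by rewrite /mevent [X in measurable X](_ : _ = setT)//; apply/seteqP; split.
Qed.

(* [corr z] is the expectation of the spin equal to 1 if [z] and to -1
   otherwise; the product of the spins of [z] and [c] is the spin of [z == c]. *)
Definition corr z : R := 2 * pr z - 1.

Lemma corr_true : corr (fun=> true) = 1.
Proof. by rewrite /corr pr_true; lra. Qed.

Lemma norm_corr_le1 z : mevent z -> `|corr z| <= 1.
Proof.
by move=> mz; have := pr_ge0 z; have := pr_le1 mz; rewrite /corr ler_norml; lra.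
Qed.

Lemma pr_sum_in (E : choiceType) (f : T -> E) (N : seq E) z : uniq N ->
    mevent z -> (forall B : set E, measurable (f @^-1` B)) ->
  pr (fun w => z w && (f w \in N)) =
  \sum_(v <- N) pr (fun w => z w && (f w == v)).
Proof.
move=> uN mz mf; have mfv v : mevent (fun w => f w == v).
  rewrite /mevent [X in measurable X](_ : _ = f @^-1` [set v]) //.
  by apply/seteqP; split=> w /= /eqP.
have mfN (s : seq E) : mevent (fun w => f w \in s).
  exact: (mf [set x | x \in s]).
elim: N uN => [_|v N IHN /= /andP[vN uN]].
  rewrite big_nil -[RHS]pr_false; congr pr; apply/funext => w.
  by rewrite in_nil andbF.
rewrite big_cons -IHN// (@pr_split (fun w => f w == v)) //; last exact: mevent_and.
congr (pr _ + pr _); apply/funext => w; rewrite inE.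
  by case: (z w); case: eqP; rewrite //= andbF.
have [->|_] := eqVneq (f w) v; first by rewrite (negPf vN) !andbF.
by rewrite andbT.
Qed.

End EventProbability.

(** * One update of a single vertex *)

Section OneStep.
Context d (T : measurableType d) (R : realType) (P : probability T R).
Context (eps : R) (G : graph) (X : nvm P eps G).
Hypothesis eps01 : 0 <= eps <= 1.
Implicit Types (z : T -> bool) (t : nat) (u v : G).

Local Notation pr := (pr P).
Local Notation corr := (corr P).

Lemma fine_bernoulli (Z : {RV P >-> bool}) p (b : bool) : 0 <= p <= 1 ->
  distribution P Z = bernoulli_prob p :> (set bool -> \bar R) ->
  fine (P (Z @^-1` [set b])) = if b then p else 1 - p.
Proof.
move=> p01 ZP; rewrite [P _](_ : _ = bernoulli_prob p [set b]); last by rewrite -ZP.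
have mem1 (c : bool) : (c \in [set b]) = (c == b).
  by apply/idP/eqP; rewrite inE.
rewrite bernoulli_probE// !diracE !mem1.
by clear; case: b => /=; rewrite mulr1 mulr0 ?addr0 ?add0r.
Qed.

(** Two splittings of the sources: those off the site against those at it, then [i] against [j]. *)
Lemma off_site_indep t u z a (B C : set T) i j :
  adapted X (off_site t u) z -> i != j -> at_site t u i -> at_site t u j ->
  source X i B -> source X j C ->
  a = fine (P B) * fine (P C) ->
  fine (P ([set w | z w] `&` (B `&` C))) = pr z * a.
Proof.
move=> az ij ui uj iB jC ->.
have FM := source_measurable (X := X); have FT := source_setT X.
have FI i0 : setI_closed (source X i0) by exact: source_setI.
have FP : mutually_independent P (source X) by exact: source_indep.
have cB : cylinder (source X) (pred1 i) B.
  by apply: (cylinder_generator (i := i)) => //=.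
have cC : cylinder (source X) (predC (pred1 i)) C.
  by apply: (cylinder_generator (i := j)) => //=; rewrite eq_sym.
have mz := adapted_measurable az.
rewrite (sigma_cylinder_indep FM FT FI FP az); last first.
  by apply: cylinder_setI => //;
    [apply: (cylinder_generator (i := i))|apply: (cylinder_generator (i := j))];
    rewrite //= /off_site negbK.
rewrite (cylinder_indep FP cB cC) !fineM// ?fin_numM ?fin_num_measure//;
  by [exact: FM iB|exact: FM jC].
Qed.

Lemma pr_fresh t u z b : adapted X (off_site t u) z ->
  pr (fun w => z w && (nvm_noise X t.+1 u w && (nvm_fresh X t.+1 u w == b))) =
  pr z * (eps / 2).
Proof.
move=> az; rewrite -(@off_site_indep t u z _ (nvm_noise X t.+1 u @^-1` [set true])
   (nvm_fresh X t.+1 u @^-1` [set b]) (inr (inl (t, u)))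
   (inr (inr (inl (t, u))))) //=; rewrite ?eqxx//.
- by congr (fine (P _)); apply/seteqP; split=> w /=; [case/and3P=> -> -> /eqP ->|
    case=> -> [-> ->]; rewrite eqxx].
- by exists [set true].
- by exists [set b].
- have half01 : 0 <= (2^-1 : R) <= 1 by apply/andP; split; lra.
  rewrite (fine_bernoulli true eps01 (nvm_noiseP X t u)).
  rewrite (fine_bernoulli b half01 (nvm_freshP X t u)).
  by case: b; congr (_ * _); lra.
Qed.

Lemma pr_copy t u v z : adapted X (off_site t u) z -> v \in neighbors u ->
  pr (fun w => z w && (~~ nvm_noise X t.+1 u w && (nvm_choice X t.+1 u w == v))) =
  pr z * ((1 - eps) / (degree u)%:R).
Proof.
move=> az vu; rewrite -(@off_site_indep t u z _ (nvm_noise X t.+1 u @^-1` [set false])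
   (nvm_choice X t.+1 u @^-1` [set v]) (inr (inl (t, u)))
   (inr (inr (inr (t, u))))) //=; rewrite ?eqxx//.
- congr (fine (P _)); apply/seteqP; split=> w /=.
    by case/and3P=> -> /negbTE -> /eqP ->.
  by case=> -> [-> ->]; rewrite eqxx.
- by exists [set false].
- by exists [set v].
- by rewrite (fine_bernoulli false eps01 (nvm_noiseP X t u)) nvm_choiceP.
Qed.

(** There is a second vertex, and a path leading to it from [u] starts at a neighbor of [u]. *)
Lemma degree_gt0 u : (0 < degree u)%N.
Proof.
rewrite /degree cardfs_gt0; apply/fset0Pn.
have [x [y xy]] := vertex_nontrivial G.
have [v uv] : exists v, v != u.
  by have [xu|xu] := eqVneq x u; [exists y; rewrite -xu eq_sym|exists x].
have [[|a p] /= up vp] := adj_connected u v; first by rewrite vp eqxx in uv.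
by exists a; rewrite in_neighbors; case/andP: up.
Qed.

Lemma measurable_choice t u (B : set G) :
  measurable (nvm_choice X t.+1 u @^-1` B).
Proof. exact: nvm_choice_measurable. Qed.

(** The [degree u] atoms, each of mass [1 / degree u], exhaust the total mass. *)
Lemma pr_choice_in t u : pr (fun w => nvm_choice X t.+1 u w \in neighbors u) = 1.
Proof.
have mT : mevent (fun _ : T => true).
  by rewrite /mevent [X in measurable X](_ : _ = setT)//; apply/seteqP; split.
rewrite [LHS](@pr_sum_in _ _ _ _ _ (nvm_choice X t.+1 u) (neighbors u)
  (fun=> true))//; last exact: measurable_choice.
rewrite (eq_big_seq (fun=> (degree u)%:R^-1)) => [|v vu] /=.
  rewrite big_const_seq count_predT iter_addr_0 -[_ *+ _]mulr_natr -/(degree u).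
  by rewrite mulVf// pnatr_eq0 -lt0n degree_gt0.
rewrite /pr [X in P X](_ : _ = nvm_choice X t.+1 u @^-1` [set v]) ?nvm_choiceP//.
by apply/seteqP; split=> w /= /eqP.
Qed.

Lemma mevent_state t u : mevent (nvm_state X t u).
Proof.
apply: (@adapted_measurable _ _ _ _ _ _ X (off_site t u)).
by apply: adapted_state; rewrite leqnn.
Qed.

(** The transition operator of the simple random walk. *)
Definition avg u (f : G -> R) := (degree u)%:R^-1 * \sum_(v <- neighbors u) f v.

Lemma mevent_source i z : source X i [set w | z w] -> mevent z.
Proof. exact: source_measurable. Qed.

(** With noise, the fresh bit agrees with [z] with probability one half, whatever [z] is. Without
    noise, the update copies a uniform neighbor chosen independently of [z] and of the states at
    time [t]. *)
Lemma pr_step t u z : adapted X (off_site t u) z ->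
  pr (fun w => z w == nvm_state X t.+1 u w) =
  eps / 2 + (1 - eps) * avg u (fun v => pr (fun w => z w == nvm_state X t v w)).
Proof.
move=> az; have mz : mevent z := adapted_measurable az.
set N := nvm_noise X t.+1 u; set C := nvm_choice X t.+1 u.
set F := nvm_fresh X t.+1 u.
have mN : mevent N.
  by apply: (mevent_source (i := inr (inl (t, u)))); exists [set true].
have mF : mevent F.
  by apply: (mevent_source (i := inr (inr (inl (t, u))))); exists [set true].
have mC : mevent (fun w => C w \in neighbors u).
  exact: (measurable_choice t u [set x | x \in neighbors u]).
have mS s v := mevent_state s v.
have mzS := mevent_eq mz (mS t.+1 u).
rewrite (pr_split P mzS mN); congr (_ + _).
  rewrite (pr_split P (mevent_and mzS mN) mF).
  transitivity (pr z * (eps / 2) + pr (fun w => ~~ z w) * (eps / 2)); last first.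
    by rewrite pr_neg//; ring.
  rewrite -(pr_fresh true az) -(pr_fresh false (adapted_neg az)).
  congr (pr _ + pr _); apply/funext => w; rewrite nvm_state_rec -/N -/F.
    by case: (z w); case: (N w); case: (F w); rewrite ?andbF.
  by case: (z w); case: (N w); case: (F w); rewrite ?andbF.
have mzN := mevent_and mzS (mevent_neg mN).
(* Choices outside the neighbors form a null event. *)
rewrite (pr_split P mzN mC) [X in _ + X](_ : _ = 0) ?addr0; last first.
  apply/eqP; rewrite eq_le pr_ge0 andbT.
  rewrite -(subrr 1) -{2}(pr_choice_in t u) -pr_neg//.
  by apply: pr_le => [||w /andP[]//]; [apply: mevent_and => //|]; exact: mevent_neg.
rewrite [LHS](pr_sum_in P (fset_uniq _) mzN (measurable_choice t u)).
rewrite /avg mulrA mulr_sumr; apply: eq_big_seq => v vu.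
rewrite mulrC -(@pr_copy t u v)//; last first.
  by apply: adapted_eq => //; apply: adapted_state; rewrite leqnn.
congr pr; apply/funext => w; rewrite nvm_state_rec -/N -/C -andbA.
case: (N w) => /=; first by rewrite !andbF.
by case: (eqVneq (C w) v) => [->|]; rewrite ?vu ?andbF.
Qed.

(** A fresh spin has mean 0, so the noise term of [pr_step] cancels. This is one backward step of
    the killed walk; [z] may carry any spins off the updated site. *)
Lemma corr_step t u z : adapted X (off_site t u) z ->
  corr (fun w => z w == nvm_state X t.+1 u w) =
  (1 - eps) * avg u (fun v => corr (fun w => z w == nvm_state X t v w)).
Proof.
move=> az; rewrite /corr pr_step// /avg big_split /= -mulr_sumr.
rewrite big_const_seq count_predT iter_addr_0 -/(degree u) -[_ *+ _]mulr_natr.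
by field; rewrite pnatr_eq0 -lt0n degree_gt0.
Qed.





End OneStep.

(** * Two-point recursion and decay of correlations *)

Section Mixing.
Context d (T : measurableType d) (R : realType) (P : probability T R).
Context (eps : R) (G : graph) (X : nvm P eps G).
Hypothesis eps01 : 0 <= eps <= 1.
Implicit Types (z : T -> bool) (s t : nat) (u v x y : G).

Local Notation corr := (corr P).
Local Notation S := (nvm_state X).

(** Two independent fair bits agree with probability 1/4 + 1/4. *)
Lemma corr_init u v : u != v -> corr (fun w => S 0 u w == S 0 v w) = 0.
Proof.
move=> uv; have half01 : 0 <= (2^-1 : R) <= 1 by apply/andP; split; lra.
have FP : mutually_independent P (source X) by exact: source_indep.
have quarter b : fine (P ((nvm_init X u @^-1` [set b]) `&`
                          (nvm_init X v @^-1` [set b]))) = 4^-1.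
  rewrite (cylinder_indep (Q := pred1 (inl u)) FP).
  - rewrite fineM ?fin_num_measure//; [|exact: measurable_funPTI..].
    rewrite (fine_bernoulli b half01 (nvm_initP X u)).
    rewrite (fine_bernoulli b half01 (nvm_initP X v)).
    by case: b; lra.
  - by apply: (cylinder_generator (F := source X) (i := inl u)) => /=; [|exists [set b]].
  - apply: (cylinder_generator (F := source X) (i := inl v)) => /=; last by exists [set b].
    by apply: contra_neq uv => -[].
have mS w : mevent (S 0 w) by exact: mevent_state.
rewrite /corr (pr_split P (c := S 0 u)); [|exact: mevent_eq|exact: mS].
rewrite [pr _ _](_ : _ = 4^-1).
  rewrite [pr _ _](_ : _ = 4^-1); first by case/andP: eps01 => *; lra.
  rewrite -(quarter false); congr (fine (P _)); apply/seteqP; split=> w /=;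
    rewrite !nvm_state0; last by move=> [-> ->].
  by case: (nvm_init X u w); case: (nvm_init X v w).
rewrite -(quarter true); congr (fine (P _)); apply/seteqP; split=> w /=;
  rewrite !nvm_state0; last by move=> [-> ->].
by case: (nvm_init X u w); case: (nvm_init X v w).
Qed.

Lemma eq_avg u (f g : G -> R) : f =1 g -> avg u f = avg u g.
Proof. by move=> fg; congr (_ * _); apply: eq_bigr => v _. Qed.

Lemma avgB u (f g : G -> R) : avg u (fun v => f v - g v) = avg u f - avg u g.
Proof. by rewrite /avg sumrB mulrBr. Qed.

Lemma avgZ u c (f : G -> R) : avg u (fun v => c * f v) = c * avg u f.
Proof. by rewrite /avg -mulr_sumr mulrCA. Qed.

Lemma norm_avg u (f : G -> R) M : (forall v, `|f v| <= M) -> `|avg u f| <= M.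
Proof.
move=> fM; rewrite /avg normrM normfV normr_nat.
rewrite mulrC ler_pdivrMr ?ltr0n ?degree_gt0//.
rewrite (le_trans (ler_norm_sum _ _ _))// (le_trans (ler_sum _ (fun v _ => fM v)))//.
by rewrite big_const_seq count_predT iter_addr_0 mulr_natr.
Qed.

(** Two uses of [corr_step]. As [x != y], the new state of [x] is off the site of [y] and can be
    carried along while [y] is updated; then the roles are exchanged, [y] having been replaced by a
    state at time [s]. *)
Lemma corr_step2 s z x y : (forall u, adapted X (off_site s u) z) -> x != y ->
  corr (fun w => z w == (S s.+1 x w == S s.+1 y w)) =
  (1 - eps) ^+ 2 * avg y (fun y' => avg x (fun x' =>
    corr (fun w => z w == (S s x' w == S s y' w)))).
Proof.
move=> az xy.
have eqbA (a b c : bool) : (a == (b == c)) = ((a == b) == c).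
  by case: a; case: b; case: c.
have eqbAC (a b c : bool) : ((a == b) == c) = ((a == c) == b).
  by case: a; case: b; case: c.
rewrite [LHS](_ : _ = corr (fun w => (z w == S s.+1 x w) == S s.+1 y w)); last first.
  by congr corr; apply/funext => w; rewrite eqbA.
rewrite corr_step//; last first.
  by apply: adapted_eq => //; apply: adapted_state; rewrite eqxx xy orbT.
rewrite expr2 -mulrA; congr (_ * _); rewrite -avgZ; apply: eq_avg => y'.
rewrite [LHS](_ : _ = corr (fun w => (z w == S s y' w) == S s.+1 x w)); last first.
  by congr corr; apply/funext => w; rewrite eqbAC.
rewrite corr_step//; last first.
  by apply: adapted_eq => //; apply: adapted_state; rewrite leqnn.
congr (_ * _); apply: eq_avg => x'; congr corr; apply/funext => w.
by rewrite eqbAC -eqbA.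
Qed.

Definition corr_at s x y := corr (fun w => S s x w == S s y w).

Lemma corr_at_diag s x : corr_at s x x = 1.
Proof.
by rewrite /corr_at -(corr_true P); congr corr; apply/funext => w; rewrite eqxx.
Qed.

(** The constant spin 1 is neutral, so correlations without an extra factor are the case [z = true]
    of the weighted recursions. *)
Lemma corr_eqtrue z : corr (fun w => true == z w) = corr z.
Proof. by congr corr; apply/funext => w; case: (z w). Qed.

Lemma corr_atS s x y : x != y ->
  corr_at s.+1 x y =
  (1 - eps) ^+ 2 * avg y (fun y' => avg x (fun x' => corr_at s x' y')).
Proof.
move=> xy; rewrite /corr_at -corr_eqtrue (corr_step2 (z := fun=> true))//.
by move=> u; exact: adapted_cst.
Qed.

Lemma mevent_adapted Q z : adapted X Q z -> mevent z.
Proof. exact: adapted_measurable. Qed.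

(** Induction on [k]. Off the diagonal both terms obey the same linear recursion, so the difference
    contracts by [(1 - eps) ^+ 2] per unit of time. On the diagonal the two spins cancel and the
    difference is 0. The initial bound is 1 + 1. *)
Lemma decorrelation s k z x y :
  (forall t u, (s <= t)%N -> adapted X (off_site t u) z) ->
  `|corr (fun w => z w == (S (s + k) x w == S (s + k) y w)) -
    corr z * corr_at (s + k) x y| <= 2 * (1 - eps) ^+ (2 * k).
Proof.
move=> az; have mz : mevent z := mevent_adapted (az s x (leqnn _)).
have mS t u := mevent_state X t u.
have delta_ge0 : 0 <= 1 - eps by case/andP: eps01 => *; lra.
elim: k x y => [|k IHk] x y.
  rewrite addn0 muln0 expr0 mulr1 (le_trans (ler_normB _ _))// (_ : 2 = 1 + 1)//.
  rewrite lerD ?norm_corr_le1//; first by apply: mevent_eq => //; exact: mevent_eq.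
  by rewrite normrM mulr_ile1 ?norm_corr_le1//; exact: mevent_eq.
have [->|xy] := eqVneq x y.
  rewrite corr_at_diag mulr1 [X in X - _](_ : _ = corr z) ?subrr ?normr0.
    by rewrite mulr_ge0// exprn_ge0.
  by congr corr; apply/funext => w; rewrite eqxx; case: (z w).
rewrite addnS corr_step2//; last by move=> u; apply: az; rewrite leq_addr.
rewrite corr_atS// [corr z * _]mulrCA -mulrBr normrM ger0_norm ?exprn_ge0//.
rewrite mulnS exprD [leRHS]mulrCA ler_wpM2l ?exprn_ge0// -avgZ -avgB.
apply: norm_avg => y'; rewrite -avgZ -avgB; exact: norm_avg.
Qed.

Definition repeat u i (w : T) := S i u w == S i.+2 u w.

Lemma adapted_repeat u i t v : (i.+2 <= t)%N -> adapted X (off_site t v) (repeat u i).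
Proof.
by move=> it; apply: adapted_eq; apply: adapted_state; rewrite ?it// ltnW// ltnW.
Qed.

Lemma mevent_repeat u i : mevent (repeat u i).
Proof. by apply: mevent_eq; exact: (mevent_state X). Qed.

(** Only the spin at time [s.+2] is moved back, twice; the spin of [u] at time [s] is already
    determined and joins [z] meanwhile. *)
Lemma corr_repeat_step s z u :
  (forall t v, (s <= t)%N -> adapted X (off_site t v) z) ->
  corr (fun w => z w == repeat u s w) =
  (1 - eps) ^+ 2 * avg u (fun v => avg v (fun v' =>
     corr (fun w => z w == (S s u w == S s v' w)))).
Proof.
move=> az.
have eqbA (a b c : bool) : (a == (b == c)) = ((a == b) == c).
  by case: a; case: b; case: c.
have ezS t v : (s <= t)%N -> adapted X (off_site t v) (fun w => z w == S s u w).
  by move=> st; apply: adapted_eq; [exact: az|apply: adapted_state; rewrite st].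
rewrite [LHS](_ : _ = corr (fun w => (z w == S s u w) == S s.+2 u w)); last first.
  by congr corr; apply/funext => w; rewrite eqbA.
rewrite corr_step//; last exact: ezS.
rewrite expr2 -mulrA; congr (_ * _); rewrite -avgZ; apply: eq_avg => v.
rewrite corr_step//; last exact: ezS.
by congr (_ * _); apply: eq_avg => v'; congr corr; apply/funext => w; rewrite eqbA.
Qed.

Lemma corr_repeatE s u : corr (repeat u s) =
  (1 - eps) ^+ 2 * avg u (fun v => avg v (fun v' => corr_at s u v')).
Proof.
rewrite -corr_eqtrue (corr_repeat_step (z := fun=> true)).
  by congr (_ * _); apply: eq_avg => y'; apply: eq_avg => x'; rewrite corr_eqtrue.
by move=> t v _; exact: adapted_cst.
Qed.

(** The first repetition is determined at time [i.+2], so [decorrelation] starts there, once the two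
    steps inside the second repetition are removed. Their factor [(1 - eps) ^+ 2] is bounded by
    1. *)
Lemma cov_repeat u i k :
  `|corr (fun w => repeat u i w == repeat u (i.+2 + k) w) -
    corr (repeat u i) * corr (repeat u (i.+2 + k))| <= 2 * (1 - eps) ^+ (2 * k).
Proof.
have delta_ge0 : 0 <= 1 - eps by case/andP: eps01 => *; lra.
have delta_le1 : 1 - eps <= 1 by case/andP: eps01 => *; lra.
have ai t v : (i.+2 <= t)%N -> adapted X (off_site t v) (repeat u i).
  exact: adapted_repeat.
rewrite corr_repeat_step//; last first.
  by move=> t v it; apply: ai; rewrite (leq_trans _ it)// leq_addr.
rewrite (corr_repeatE (i.+2 + k)) [corr (repeat u i) * _]mulrCA -mulrBr.
rewrite normrM ger0_norm ?exprn_ge0//.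
rewrite -[leRHS]mul1r ler_pM ?exprn_ge0 ?exprn_ile1// -avgZ -avgB.
apply: norm_avg => v; rewrite -avgZ -avgB; apply: norm_avg => v'.
exact: decorrelation.
Qed.

End Mixing.

(** * Unit steps and parity on the integer lattice *)

Section LatticeSteps.
Variable d : nat.
Implicit Types (u v y : 'rV[int]_d) (x : 'I_d * bool).

(** The signed unit vectors, [true] standing for the minus sign. *)
Definition step x : 'rV[int]_d := (-1) ^+ x.2 *: delta_mx 0 x.1.

Lemma stepE x j : step x 0 j = (-1) ^+ x.2 * (j == x.1)%:R.
Proof. by rewrite !mxE eqxx. Qed.

Lemma step_inj : injective step.
Proof.
move=> [i a] [j b] /rowP ij; have := ij i; rewrite !stepE /= eqxx mulr1.
have [<-|_] := eqVneq i j; first by case: a b {ij} => -[].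
by rewrite mulr0 => /eqP; rewrite signr_eq0.
Qed.

Lemma stepN x : step (x.1, ~~ x.2) = - step x.
Proof. by rewrite /step /= signrN scaleNr. Qed.

(** For the forward direction, a unit step towards [v] along a differing coordinate lowers the
    distance from 1 to 0, so it lands on [v]. *)
Lemma lattice_adjP u v :
  reflect (exists x, v = u + step x) (lattice_adj u v).
Proof.
apply: (iffP idP) => [uv|[x ->]]; last first.
  rewrite /lattice_adj /dist1 (bigD1 x.1)//= big1 => [|j /negPf jx].
    by rewrite mxE stepE eqxx mulr1 opprD addNKr normrN normr_sign addr0.
  by rewrite mxE stepE jx mulr0 addr0 subrr normr0.
have [i ui] : exists i, u 0 i != v 0 i.
  apply/existsP; apply: contraTT uv => /existsPn uv.
  rewrite /lattice_adj /dist1 big1// => i _.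
  by rewrite (eqP (negbNE (uv i))) subrr normr0.
have [_] := dist1_step ui; move: uv; rewrite {1}/lattice_adj => /eqP ->.
rewrite -{1}[1]add0r => /addIr/esym/eqP; rewrite psumr_eq0// => /allP wv.
exists (i, v 0 i - u 0 i < 0); rewrite /step /=.
rewrite -[(-1) ^+ _](_ : Num.sg (v 0 i - u 0 i) = _); last first.
  by rewrite sgr_def subr_eq0 eq_sym ui mulr1n.
apply/rowP => j; have /= := wv j (mem_index_enum _).
by rewrite normr_eq0 subr_eq0 => /eqP.
Qed.

Lemma perm_lattice_neighbors (d_gt0 : (0 < d)%N) (u : lattice d_gt0) :
  perm_eq (neighbors u) [seq (u : 'rV[int]_d) + step x | x : 'I_d * bool].
Proof.
apply: uniq_perm => [//||v].
  by rewrite map_inj_uniq ?enum_uniq// => x x' /addrI/step_inj.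
rewrite in_neighbors; apply/lattice_adjP/mapP => [[x ->]|[x _ ->]].
- by exists x => //; rewrite mem_enum.
- by exists x.
Qed.

Lemma degree_lattice (d_gt0 : (0 < d)%N) (u : lattice d_gt0) : degree u = d.*2.
Proof.
rewrite /degree (perm_size (perm_lattice_neighbors u)) size_map -cardE.
by rewrite card_prod card_ord card_bool muln2.
Qed.

Definition parity y : bool := odd (absz (\sum_j y 0 j)).

Lemma parity0 : parity 0 = false.
Proof. by rewrite /parity big1// => j _; rewrite mxE. Qed.

Lemma parity_step y x : parity (y + step x) = ~~ parity y.
Proof.
rewrite /parity [X in absz X](_ : _ = \sum_j y 0 j + (-1) ^+ x.2); last first.
  under eq_bigr do rewrite mxE stepE.
  rewrite big_split/= [X in _ + X](bigD1 x.1)//= [X in _ + (_ + X)]big1 => [|j /negPf ->].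
    by rewrite eqxx mulr1 addr0.
  by rewrite mulr0.
by case: x.2; rewrite ?expr1 ?expr0; lia.
Qed.

End LatticeSteps.

(** * Hitting and return probabilities of the killed simple random walk *)

Section Hitting.
Context (R : realType) (delta : R).
Hypothesis delta_gt0 : 0 < delta.
Hypothesis delta_lt1 : delta < 1.

Let delta_ge0 : 0 <= delta := ltW delta_gt0.

Section Fixed.
Variable d : nat.
Hypothesis d_gt0 : (0 < d)%N.
Implicit Types (y : 'rV[int]_d) (f g : 'rV[int]_d -> R).

Definition nbr_avg f y : R := d.*2%:R^-1 * \sum_(x : 'I_d * bool) f (y + step x).

(* The probability that a simple random walk from [y], surviving each step with
   probability [delta], visits 0 within [n] steps. *)
Fixpoint hit n y : R :=
  if n is m.+1 then if y == 0 then 1 else delta * nbr_avg (hit m) y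
  else (y == 0)%:R.

Lemma nbr_avg_ge0 f y : (forall z, 0 <= f z) -> 0 <= nbr_avg f y.
Proof. by move=> f0; rewrite mulr_ge0// sumr_ge0. Qed.

Lemma le_nbr_avg f g y : (forall z, f z <= g z) -> nbr_avg f y <= nbr_avg g y.
Proof. by move=> fg; rewrite ler_wpM2l// ler_sum. Qed.

Lemma nbr_avg_cst c y : nbr_avg (fun=> c) y = c.
Proof.
rewrite /nbr_avg sumr_const card_prod card_ord card_bool muln2 -[c *+ _]mulr_natl mulKf//.
by rewrite pnatr_eq0 double_eq0 -lt0n.
Qed.

Lemma hit_ge0 n y : 0 <= hit n y.
Proof.
elim: n y => [|n IHn] y /=; first by case: eqP.
by case: eqP => // _; rewrite mulr_ge0// nbr_avg_ge0.
Qed.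

Lemma hit0 n : hit n 0 = 1.
Proof. by case: n => [|n] /=; rewrite eqxx. Qed.

Lemma hit_le1 n y : hit n y <= 1.
Proof.
elim: n y => [|n IHn] y /=; first by case: eqP.
case: eqP => // _; rewrite mulr_ile1 ?nbr_avg_ge0 ?(ltW delta_lt1)//; [exact: hit_ge0|].
by rewrite -[leRHS](nbr_avg_cst 1 y); exact: le_nbr_avg.
Qed.

Lemma hit_leS n y : hit n y <= hit n.+1 y.
Proof.
elim: n y => [|n IHn] y.
  have [->|y0] := eqVneq y 0; first by rewrite !hit0.
  by rewrite {1}/hit (negPf y0) hit_ge0.
rewrite [hit n.+1 y]/= [hit n.+2 y]/=; case: eqP => // _.
by rewrite ler_wpM2l// le_nbr_avg.
Qed.

Lemma hit_nondecreasing y : nondecreasing_seq (hit ^~ y).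
Proof. by apply/nondecreasing_seqP => n; exact: hit_leS. Qed.

Definition hitting y : R := limn (hit ^~ y).

Lemma cvg_hit y : hit n y @[n --> \oo] --> hitting y.
Proof.
apply: nondecreasing_is_cvgn; first exact: hit_nondecreasing.
by exists 1 => _ [n _ <-]; exact: hit_le1.
Qed.

Lemma hit_le_hitting n y : hit n y <= hitting y.
Proof.
apply: nondecreasing_cvgn_le; first exact: hit_nondecreasing.
by apply/cvg_ex; exists (hitting y); exact: cvg_hit.
Qed.

Lemma hitting_le y c : (forall n, hit n y <= c) -> hitting y <= c.
Proof.
move=> hc; apply: limr_le; first by apply/cvg_ex; exists (hitting y); exact: cvg_hit.
by apply: nearW.
Qed.

Lemma hitting0 : hitting 0 = 1.
Proof.
apply/eqP; rewrite eq_le hitting_le => [|n]; last by rewrite hit0.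
by rewrite -(hit0 0) hit_le_hitting.
Qed.

Lemma cvg_nbr_avg y : nbr_avg (hit n) y @[n --> \oo] --> nbr_avg hitting y.
Proof.
apply: cvgMl_tmp; apply: cvg_big => [|x _]; last exact: cvg_hit.
by move=> x; exact: add_continuous.
Qed.

(** The limit of the one-step recursion of [hit]. *)
Lemma hittingE y : y != 0 -> hitting y = delta * nbr_avg hitting y.
Proof.
move=> y0; apply: (@cvg_unique _ (@Rhausdorff R) (hit n.+1 y @[n --> \oo])).
  have := @cvg_hit y; rewrite -(cvg_shiftS (hit ^~ y)); exact.
rewrite /= (negPf y0); apply: cvgMl_tmp; exact: cvg_nbr_avg.
Qed.

Lemma hitting_step_gt0 x : 0 < hitting (step x).
Proof.
apply: lt_le_trans (hit_le_hitting 1 _); rewrite /=; case: eqP => // _.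
rewrite mulr_gt0// /nbr_avg mulr_gt0 ?invr_gt0 ?ltr0n ?double_gt0//.
(* The opposite step leads straight back to 0 and already has positive weight. *)
rewrite (bigD1 (x.1, ~~ x.2))//= stepN subrr eqxx ltr_pwDl// sumr_ge0//.
Qed.

End Fixed.

(** * Comparison of dimensions by projecting onto some of the coordinates *)

Section Projection.
Variables (d d' : nat) (e : 'I_d -> 'I_d').
Hypothesis d_gt0 : (0 < d)%N.
Hypothesis e_inj : injective e.
Implicit Types y : 'rV[int]_d'.

Definition proj y : 'rV[int]_d := \row_j y 0 (e j).

Let d'_gt0 : (0 < d')%N.
Proof. by case: d' e => // e'; have [] := e' (Ordinal d_gt0). Qed.

Let d_le_d' : (d <= d')%N.
Proof. by have := leq_card _ e_inj; rewrite !card_ord. Qed.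

Lemma proj_step y i s : proj (y + step (e i, s)) = proj y + step (i, s).
Proof. by apply/rowP => j; rewrite !mxE /= (inj_eq e_inj). Qed.

Lemma proj_step_off y k s : k \notin codom e -> proj (y + step (k, s)) = proj y.
Proof.
move=> ke; apply/rowP => j; rewrite !mxE /=.
have /negPf -> : e j != k by apply: contraNneq ke => <-; exact: codom_f.
by rewrite mulr0 addr0.
Qed.

(** Of the [d'] directions, [d] move the projection like a simple random walk, and the other
    [d' - d] leave it in place. *)
Lemma nbr_avg_proj (f : 'rV[int]_d -> R) y :
  d'%:R * nbr_avg (f \o proj) y =
  d%:R * nbr_avg f (proj y) + (d' - d)%:R * f (proj y).
Proof.
have avgE n (F : 'I_n * bool -> R) : (0 < n)%N ->
    n%:R * (n.*2%:R^-1 * \sum_x F x) = 2^-1 * \sum_i (F (i, true) + F (i, false)).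
  move=> n0; rewrite (eq_bigr (fun x => F (x.1, x.2))); last by case.
  rewrite -(pair_big xpredT xpredT (fun i s => F (i, s)))/=.
  rewrite mulrA -mul2n natrM invfM mulrCA mulfV ?mulr1 ?pnatr_eq0 -?lt0n//.
  by congr (_ * _); apply: eq_bigr => i _; rewrite big_bool.
rewrite /nbr_avg !avgE//=.
rewrite (bigID (mem (codom e)))/= mulrDr; congr (_ + _).
  rewrite -(big_uniq _ (_ : uniq (codom e))) /=; last by rewrite map_inj_uniq ?enum_uniq.
  rewrite big_image /=; congr (_ * _); apply: eq_bigr => i _.
  by rewrite !proj_step.
rewrite (eq_bigr (fun=> 2 * f (proj y))) => [|k ke]; last first.
  by rewrite !proj_step_off// mulr_natl mulr2n.
rewrite sumr_const -mulrnAr mulrA mulVf ?pnatr_eq0// mul1r -mulr_natl.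
congr (_%:R * _); have := cardC (mem (codom e)).
by rewrite card_codom// !card_ord => d'E; rewrite -[X in _ = (X - d)%N]d'E addKn.
Qed.

Lemma proj0 : proj 0 = 0.
Proof. by apply/rowP => j; rewrite !mxE. Qed.

(* Each step of the walk on the larger lattice that the projection does not see
   costs a factor [delta]. *)
Lemma nbr_avg_hitting_proj y : proj y != 0 ->
  d'%:R * (delta * nbr_avg (@hitting d \o proj) y) =
  (d%:R + delta * (d' - d)%:R) * hitting (proj y).
Proof.
move=> y0; rewrite mulrCA nbr_avg_proj mulrDr mulrDl mulrCA -hittingE//.
by rewrite mulrA.
Qed.

(** Away from the zeros of [proj], [hitting \o proj] dominates [delta] times its neighbor average,
    as [d + delta * (d' - d) <= d']. Where [proj y = 0] it equals 1. It therefore bounds [hit n] by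
    induction on [n]. *)
Lemma hit_le_proj n y : hit n y <= hitting (proj y).
Proof.
elim: n y => [|n IHn] y; have [->|y0] := eqVneq y 0.
- by rewrite proj0 hitting0// hit0.
- by rewrite /= (negPf y0) (le_trans _ (hit_le_hitting d_gt0 0 _))// hit_ge0.
- by rewrite proj0 hitting0// hit0.
have [->|py0] := eqVneq (proj y) 0; first by rewrite hitting0// hit_le1.
rewrite [hit _ _]/= (negPf y0) -(ler_pM2l (_ : 0 < d'%:R)) ?ltr0n//.
apply: (@le_trans _ _ (d'%:R * (delta * nbr_avg (@hitting d \o proj) y))).
  by rewrite ler_wpM2l// ler_wpM2l// le_nbr_avg.
rewrite nbr_avg_hitting_proj// ler_wpM2r//.
  by rewrite (le_trans _ (hit_le_hitting d_gt0 0 _))// hit_ge0.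
rewrite -[in leRHS](subnKC d_le_d') natrD lerD2l ler_piMl//; exact: ltW.
Qed.

Lemma hitting_le_proj y : hitting y <= hitting (proj y).
Proof. by apply: hitting_le => // n; exact: hit_le_proj. Qed.

(** One further step of the recursion turns the weak bound strict: now [d + delta * (d' - d) < d'],
    multiplied by a positive hitting probability. *)
Lemma hitting_lt_proj y : (d < d')%N -> proj y != 0 -> 0 < hitting (proj y) ->
  hitting y < hitting (proj y).
Proof.
move=> dd' py0 hy; have y0 : y != 0 by apply: contraNneq py0 => ->; rewrite proj0.
rewrite hittingE// -(ltr_pM2l (_ : 0 < d'%:R)) ?ltr0n//.
apply: (@le_lt_trans _ _ (d'%:R * (delta * nbr_avg (@hitting d \o proj) y))).
  by rewrite ler_wpM2l// ler_wpM2l// le_nbr_avg// => z; exact: hitting_le_proj.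
rewrite nbr_avg_hitting_proj// ltr_pM2r// -[in ltRHS](subnKC d_le_d') natrD.
by rewrite ltrD2l gtr_pMl// ltr0n subn_gt0.
Qed.

End Projection.

(** The first step is taken separately, because [hitting 0] counts the visit at time 0. *)
Definition return_prob d : R := delta * nbr_avg (@hitting d) 0.

Lemma step_neq0 d (x : 'I_d * bool) : step x != 0.
Proof.
apply/eqP => /rowP/(_ x.1)/eqP; rewrite stepE mxE eqxx mulr1.
by rewrite signr_eq0.
Qed.

Lemma hitting_step_lt d d' (x : 'I_d * bool) (k : 'I_d') :
  (d < d')%N -> hitting (step (k, x.2)) < hitting (step x).
Proof.
move=> dd'; have d_gt0 : (0 < d)%N := leq_ltn_trans (leq0n _) (ltn_ord x.1).
(* The transposition makes direction [x.1] correspond to [k], so that [step (k, x.2)] projects onto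
   [step x]. *)
pose e i := tperm (widen_ord (ltnW dd') x.1) k (widen_ord (ltnW dd') i).
have e_inj : injective e.
  by move=> i j /perm_inj/(congr1 val) /= ij; apply: val_inj.
have ek : e x.1 = k by rewrite /e tpermL.
have pk : proj e (step (k, x.2)) = step x.
  have := proj_step e_inj 0 x.1 x.2; rewrite ek add0r proj0 add0r => ->.
  by rewrite -surjective_pairing.
rewrite -pk; apply: hitting_lt_proj => //; first by rewrite pk step_neq0.
by rewrite pk hitting_step_gt0.
Qed.

(** After clearing denominators, every direction of one lattice is compared with every direction of
    the other, sign by sign. This avoids showing that all directions of a lattice have equal hitting
    probabilities. *)
Lemma return_prob_decr d d' : (0 < d)%N -> (d < d')%N ->
  return_prob d' < return_prob d.
Proof.
move=> d_gt0 dd'; have d'_gt0 : (0 < d')%N := leq_ltn_trans (leq0n _) dd'.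
rewrite /return_prob ltr_pM2l// /nbr_avg.
have pairE n (F : 'I_n * bool -> R) : \sum_x F x = \sum_i \sum_s F (i, s).
  by rewrite pair_big; apply: eq_bigr => -[].
rewrite ltr_pdivrMl ?ltr0n ?double_gt0// mulrCA ltr_pdivlMl ?ltr0n ?double_gt0//.
rewrite -!mul2n !natrM -!mulrA ltr_pM2l// !pairE.
have cstE n (c : R) : n%:R * c = \sum_(i < n) c.
  by rewrite sumr_const card_ord mulr_natl.
rewrite !cstE [ltRHS]exchange_big /=.
apply: ltr_sum => [|i _]; first by apply/hasP; exists (Ordinal d_gt0); rewrite ?mem_index_enum.
apply: ltr_sum => [|k _]; first by apply/hasP; exists (Ordinal d'_gt0); rewrite ?mem_index_enum.
apply: ltr_sum => [|s _]; first by apply/hasP; exists true; rewrite ?mem_index_enum.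
by rewrite !add0r; exact: (hitting_step_lt (i, s)).
Qed.


End Hitting.

(** * Lattice correlations as hitting probabilities *)

Section LatticeNVM.
Context d0 (T : measurableType d0) (R : realType) (P : probability T R).
Context (eps : R) (d : nat) (d_gt0 : (0 < d)%N).
Context (X : nvm P eps (lattice d_gt0)).
Hypothesis eps01 : 0 <= eps <= 1.
Implicit Types u v : lattice d_gt0.

Local Notation delta := (1 - eps).

Lemma avg_lattice u (f : 'rV[int]_d -> R) :
  avg u f = d.*2%:R^-1 * \sum_x f ((u : 'rV[int]_d) + step x).
Proof.
rewrite /avg degree_lattice; congr (_ * _).
by rewrite (perm_big _ (perm_lattice_neighbors u)) /= big_map big_enum.
Qed.

Lemma sum_stepN (f : 'rV[int]_d -> R) y :
  \sum_(x : 'I_d * bool) f (y - step x) = \sum_(x : 'I_d * bool) f (y + step x).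
Proof.
pose flip (x : 'I_d * bool) := (x.1, ~~ x.2).
rewrite [RHS](reindex_inj (h := flip)) /=.
  by apply: eq_bigr => x _; rewrite stepN.
by move=> [i a] [j b] [-> /(congr1 negb)]; rewrite !negbK => ->.
Qed.

(* The coordinate sum of the difference of two walkers moving simultaneously
   keeps its parity, so their meeting is the return of a single walk running at
   double speed: no visit to 0 is missed between two of its even times. *)
Lemma corr_at_lattice s u v : ~~ parity ((v : 'rV[int]_d) - u) ->
  corr_at X s u v = hit delta s.*2 ((v : 'rV[int]_d) - u).
Proof.
elim: s u v => [|s IHs] u v uv.
  have [->|neq] := eqVneq u v; first by rewrite corr_at_diag subrr hit0.
  rewrite /corr_at corr_init//= subr_eq0.
  by rewrite eq_sym (negPf neq).
have [<-|neq] := eqVneq u v; first by rewrite corr_at_diag subrr hit0.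
rewrite corr_atS// doubleS [RHS]/= subr_eq0 eq_sym (negPf neq) expr2 -mulrA.
congr (_ * _); rewrite (avg_lattice v) mulrCA; congr (_ * _).
rewrite mulr_sumr; apply: eq_bigr => x _.
have odd_x : parity ((v : 'rV[int]_d) - u + step x) by rewrite parity_step.
case: eqP odd_x => [->|_ odd_x]; first by rewrite parity0.
congr (_ * _); rewrite (avg_lattice u) /nbr_avg; congr (_ * _).
rewrite -sum_stepN; apply: eq_bigr => x' _.
have dE : (v : 'rV[int]_d) + step x - (u + step x') = v - u + step x - step x'.
  by rewrite opprD addrA [v + _ - u]addrAC.
by rewrite IHs dE// -stepN !parity_step !negbK.
Qed.

(** Two steps of the later spin produce an even displacement, after which [corr_at_lattice] gives
    [s.*2] more steps. The second step is absorbed into [hit] because the first never ends at 0. *)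
Lemma corr_repeat_lattice s u :
  corr P (repeat X u s) = delta * nbr_avg (hit delta s.*2.+1) (0 : 'rV[int]_d).
Proof.
rewrite corr_repeatE// expr2 -mulrA; congr (_ * _).
rewrite (avg_lattice u) mulrCA; congr (_ * _); rewrite mulr_sumr.
apply: eq_bigr => x _; rewrite add0r /= (negPf (step_neq0 x)); congr (_ * _).
rewrite (avg_lattice (u + step x)); congr (_ * _); apply: eq_bigr => x' _.
have dE : (u : 'rV[int]_d) + step x + step x' - u = step x + step x'.
  by rewrite addrC -!addrA addKr.
by rewrite corr_at_lattice dE// -[step x]add0r !parity_step parity0.
Qed.

End LatticeNVM.

Lemma cvg_return_prob (R : realType) (delta : R) (d : nat) :
  0 < delta -> delta < 1 -> (0 < d)%N ->
  delta * nbr_avg (hit delta s.*2.+1) (0 : 'rV[int]_d) @[s --> \oo] -->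
  return_prob delta d.
Proof.
move=> delta_gt0 delta_lt1 d_gt0; apply: cvgMl_tmp.
apply: (@cvg_comp _ _ _ (fun s => s.*2.+1)
  (fun n => nbr_avg (hit delta n) (0 : 'rV[int]_d)) _ \oo); last exact: cvg_nbr_avg.
move=> A [N _ NA]; exists N => // n /= Nn; apply: NA => /=; lia.
Qed.

(** * Chebyshev's inequality for sums of weakly correlated spins *)

Section Chebyshev.
Context d (T : measurableType d) (R : realType) (P : probability T R).
Implicit Types z : T -> bool.

Local Notation pr := (pr P).
Local Notation corr := (corr P).

(** Positivity of the expectation of a finite combination of indicators on [z]. Splitting [z] along
    [b k] makes that indicator constant on each piece, so its coefficient is absorbed into [c]. *)
Lemma pr_comb_ge0 (K : Type) (r : seq K) (a : K -> R) (b : K -> T -> bool) z c :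
    mevent z -> (forall k, mevent (b k)) ->
    (forall w, z w -> 0 <= c + \sum_(k <- r) a k * (b k w)%:R) ->
  0 <= c * pr z + \sum_(k <- r) a k * pr (fun w => z w && b k w).
Proof.
move=> mz mb; elim: r c z mz => [|k r IHr] c z mz zc.
  rewrite big_nil addr0; have [[w zw]|z0] := pselect (exists w, z w).
    by rewrite mulr_ge0 ?pr_ge0//; have := zc _ zw; rewrite big_nil addr0.
  rewrite (_ : z = fun=> false) ?pr_false ?mulr0//.
  by apply/funext => w; apply/negP => zw; apply: z0; exists w.
have mk := mevent_and mz (mb k); have mnk := mevent_and mz (mevent_neg (mb k)).
have := IHr (c + a k) _ mk.
have := IHr c _ mnk.
move=> /(_ _)/wrap[w /andP[zw /negbTE bkw]|].
  by have := zc w zw; rewrite big_cons bkw mulr0 add0r.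
move=> {}IHn /(_ _)/wrap[w /andP[zw bkw]|].
  by have := zc w zw; rewrite big_cons bkw mulr1 addrA.
move=> {}IHr; rewrite big_cons.
rewrite (pr_split P mz (mb k)).
rewrite [X in _ <= _ + (_ + X)](_ : _ =
    \sum_(i <- r) a i * pr (fun w => (z w && b k w) && b i w) +
    \sum_(i <- r) a i * pr (fun w => (z w && ~~ b k w) && b i w)).
  by move: IHn IHr; set s1 := \sum_(i <- r) _; set s2 := \sum_(i <- r) _; lra.
rewrite -big_split; apply: eq_bigr => i _ /=; rewrite -mulrDr.
rewrite (pr_split P (mevent_and mz (mb i)) (mb k)); congr (_ * (pr _ + pr _)).
  by apply/funext => w; rewrite andbAC.
by apply/funext => w; rewrite andbAC.
Qed.

(** [pr_comb_ge0] is applied on [z] and on its complement, and the two inequalities are added. *)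
Lemma pr_markov (K : Type) (r : seq K) (a : K -> R) (b : K -> T -> bool) z c l :
    mevent z -> (forall k, mevent (b k)) ->
    (forall w, l * (z w)%:R <= c + \sum_(k <- r) a k * (b k w)%:R) ->
  l * pr z <= c + \sum_(k <- r) a k * pr (b k).
Proof.
move=> mz mb zl.
have in_z : forall w, z w -> 0 <= (c - l) + \sum_(k <- r) a k * (b k w)%:R.
  by move=> w zw; have := zl w; rewrite zw mulr1; lra.
have off_z : forall w, ~~ z w -> 0 <= c + \sum_(k <- r) a k * (b k w)%:R.
  by move=> w /negbTE zw; have := zl w; rewrite zw mulr0.
have := pr_comb_ge0 mz mb in_z; have := pr_comb_ge0 (mevent_neg mz) mb off_z.
rewrite pr_neg// => offE inE.
rewrite (eq_bigr (fun k => a k * pr (fun w => z w && b k w) +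
                           a k * pr (fun w => ~~ z w && b k w))) => [|k _].
  rewrite big_split /=; move: offE inE.
  by set s1 := \sum_(i <- r) _; set s2 := \sum_(i <- r) _; lra.
rewrite -mulrDr (pr_split P (mb k) mz); congr (_ * (pr _ + pr _));
  by apply/funext => w; rewrite andbC.
Qed.

Variable b : nat -> T -> bool.
Hypothesis mb : forall i, mevent (b i).

Definition spin_sum n w : R := \sum_(i < n) (2 * (b i w)%:R - 1 - corr (b i)).

Definition cov i j : R :=
  corr (fun w => b i w == b j w) - corr (b i) * corr (b j).

Lemma spin_chebyshev n z l : mevent z ->
    (forall w, z w -> l <= spin_sum n w ^+ 2) ->
  l * pr z <= \sum_(i < n) \sum_(j < n) cov i j.
Proof.
move=> mz zl; pose M := \sum_(i < n) corr (b i).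
(* These coefficients and [c] below come from expanding the square of the sum of spins minus [M]: a
   product of two spins is [2 * (b i == b j) - 1], and a single spin is [2 * b i - 1]. *)
pose a (k : 'I_n * 'I_n + 'I_n) := if k is inl _ then 2 else - 4 * M.
pose e (k : 'I_n * 'I_n + 'I_n) :=
  match k with inl ij => fun w => b ij.1 w == b ij.2 w | inr i => b i end.
have me k : mevent (e k) by case: k => [[i j]|i] //=; exact: mevent_eq.
have sumE (F : 'I_n * 'I_n + 'I_n -> R) : \sum_k F k =
    \sum_(i < n) \sum_(j < n) F (inl (i, j)) + \sum_(i < n) F (inr i).
  by rewrite big_sumType /= pair_big; congr (_ + _); apply: eq_bigr => -[].
have constE (c : R) : \sum_(i < n) c = n%:R * c.
  by rewrite sumr_const card_ord mulr_natl.
have prodE (x : 'I_n -> R) : \sum_i \sum_j x i * x j = (\sum_i x i) ^+ 2.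
  by rewrite expr2 mulr_suml; apply: eq_bigr => i _; rewrite mulr_sumr.
pose c := M ^+ 2 + 2 * n%:R * M - n%:R ^+ 2.
have spinE w : spin_sum n w ^+ 2 = c + \sum_k a k * (e k w)%:R.
  have -> : spin_sum n w = 2 * (\sum_(i < n) (b i w)%:R) - n%:R - M.
    by rewrite /spin_sum /M /corr !sumrB -mulr_sumr constE mulr1.
  rewrite sumE /= -mulr_sumr; set B := \sum_(i < n) _.
  suff -> : \sum_(i < n) \sum_(j < n) 2 * ((b i w == b j w)%:R : R) =
      4 * B ^+ 2 - 4 * n%:R * B + 2 * n%:R ^+ 2 by rewrite /c; ring.
  transitivity (\sum_(i < n) \sum_(j < n) (4 * ((b i w)%:R * (b j w)%:R) -
      2 * (b i w)%:R - 2 * (b j w)%:R + 2) : R).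
    by do 2 apply: eq_bigr => ? _; case: (b _ w); case: (b _ w) => /=; lra.
  transitivity (\sum_(i < n) (4 * (\sum_(j < n) (b i w)%:R * (b j w)%:R) -
      n%:R * (2 * (b i w)%:R) - 2 * B + n%:R * 2)).
    by apply: eq_bigr => i _; rewrite big_split /= !sumrB -!mulr_sumr !constE -/B; ring.
  by rewrite big_split /= !sumrB -!mulr_sumr prodE !constE -/B; ring.
rewrite (le_trans (pr_markov (c := c) (l := l) (r := index_enum _) (a := a) mz me _))//.
  move=> w; rewrite -spinE; case: (boolP (z w)) => [/zl|_]; first by rewrite mulr1.
  by rewrite mulr0 sqr_ge0.
rewrite sumE /= -mulr_sumr.
have -> : \sum_(i < n) pr (b i) = 2^-1 * (M + n%:R).
  rewrite /M /corr sumrB -mulr_sumr constE; lra.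
rewrite [leRHS](eq_bigr (fun i : 'I_n =>
  \sum_(j < n) 2 * pr (fun w => b i w == b j w) - n%:R * 1 -
  \sum_(j < n) corr (b i) * corr (b j))) => [|i _]; last first.
  by rewrite -constE -!sumrB; apply: eq_bigr => j _.
by rewrite !sumrB prodE constE -/M /c; lra.
Qed.

Variable rho : R.
Hypothesis rho01 : 0 < rho < 1.
Hypothesis cov_decay : forall i k, `|cov i (i.+2 + k)| <= 2 * rho ^+ k.

Lemma covC i j : cov i j = cov j i.
Proof.
rewrite /cov mulrC; congr (corr _ - _); apply/funext => w; exact: eq_sym.
Qed.

Lemma norm_cov_le2 i j : `|cov i j| <= 2.
Proof.
rewrite (le_trans (ler_normB _ _))// (_ : 2 = 1 + 1)// lerD//.
  by apply: norm_corr_le1; exact: mevent_eq.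
by rewrite normrM mulr_ile1 ?norm_corr_le1.
Qed.

(** Lag 1 is outside [cov_decay]; the trivial bound 2 covers it, whence the factor [2 / rho]. *)
Lemma cov_le i j : (i < j)%N -> cov i j <= 2 / rho * rho ^+ (j - i.+1).
Proof.
move=> ij; case/andP: rho01 => rho_gt0 rho_lt1.
rewrite (le_trans (ler_norm _))//.
have [k jE] : exists k, j = (i.+1 + k)%N by exists (j - i.+1)%N; rewrite subnKC.
rewrite {ij}jE addKn; case: k => [|k].
  rewrite expr0 mulr1 (le_trans (norm_cov_le2 _ _))//.
  by rewrite ler_peMr// invf_ge1// ltW.
by rewrite addnS -addSn exprS mulrA divfK ?gt_eqF.
Qed.

Lemma sum_cov_le n : \sum_(i < n) cov i n <= 2 / rho / (1 - rho).
Proof.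
case/andP: rho01 => rho_gt0 rho_lt1.
rewrite (le_trans (ler_sum _ (fun i _ => cov_le (ltn_ord i))))//.
rewrite -mulr_sumr ler_wpM2l ?divr_ge0 ?(ltW rho_gt0)//.
rewrite (reindex_inj rev_ord_inj) /=.
rewrite (eq_bigr (fun i : 'I_n => rho ^+ i)) => [|i _]; last first.
  by congr (_ ^+ _); have := ltn_ord i; lia.
rewrite -[leRHS]mul1r ler_pdivlMr ?subr_gt0// mulrC.
have := subrX1 rho n; have := exprn_ge0 n (ltW rho_gt0).
by set s := \sum_(i < n) _; lra.
Qed.

(** Each new index adds a row and a column, bounded uniformly by a geometric series, and a diagonal
    term at most 2. The variance of the sum thus grows at most linearly. *)
Lemma sum_sum_cov_le n : \sum_(i < n) \sum_(j < n) cov i j <=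
  n%:R * (2 * (2 / rho / (1 - rho)) + 2).
Proof.
elim: n => [|n IHn]; first by rewrite big_ord0 mul0r.
rewrite big_ord_recr /= (eq_bigr (fun i : 'I_n => \sum_(j < n) cov i j + cov i n)) =>
  [|i _]; last by rewrite big_ord_recr.
rewrite big_split /= big_ord_recr /=.
rewrite [X in _ + (X + _)](eq_bigr (fun i : 'I_n => cov i n)) => [|i _];
  last exact: covC.
have := sum_cov_le n; have := le_trans (ler_norm _) (norm_cov_le2 n n).
rewrite -natr1 mulrDl mul1r; move: IHn.
by set s := \sum_(i < n) cov i n; set s2 := \sum_(i < n) _; lra.
Qed.

End Chebyshev.

(** * Convergence in probability of the repetition statistic *)

Section Concentration.
Context d0 (T : measurableType d0) (R : realType) (P : probability T R).
Context (eps : R) (d : nat) (d_gt0 : (0 < d)%N).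
Hypothesis eps_gt0 : 0 < eps.
Hypothesis eps_lt1 : eps < 1.
Context (X : nvm P eps (lattice d_gt0)) (u : lattice d_gt0).

Local Notation pr := (pr P).

Let eps01 : 0 <= eps <= 1.
Proof. by rewrite !ltW. Qed.

Let delta_gt0 : 0 < 1 - eps.
Proof. by rewrite subr_gt0. Qed.

Let delta_lt1 : 1 - eps < 1.
Proof. by rewrite ltrBlDr ltrDl. Qed.

(** The shift by one matches the statistic, whose sum starts at time 1. *)
Let b i := repeat X u i.+1.

Let mb i : mevent (b i).
Proof. exact: mevent_repeat. Qed.

Let stat t w : R := repetition_statistic R 2 (observations X u (t:=t) w).

Lemma repetition_statisticE n w :
  stat n.+2 w = n%:R^-1 * \sum_(i < n) (b i w)%:R.
Proof.
rewrite /stat /repetition_statistic subn2 /=; congr (_ * _).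
rewrite big_add1 /= big_mkord; apply: eq_bigr => i _; congr (_%:R).
by rewrite /b /repeat /observations !inordK ?addn2//; have := ltn_ord i; lia.
Qed.

Lemma measurable_stat n : measurable_fun setT (stat n.+2).
Proof.
rewrite (_ : stat _ = fun w => n%:R^-1 * \sum_(i < n) (b i w)%:R); last first.
  by apply/funext => w; exact: repetition_statisticE.
apply: measurable_funM => //; apply: measurable_sum => i.
rewrite (_ : (fun w => _) = \1_[set w | b i w]); first by apply: measurable_indic; exact: mb.
by apply/funext => w; rewrite indicE (_ : (w \in _) = b i w)//; apply/idP/idP; rewrite inE.
Qed.

(** An event of spin expectation [r] has probability [(1 + r) / 2]. *)
Definition limit_stat : R := 2^-1 * (1 + return_prob (1 - eps) d).

Definition close (kappa : R) t w := `|stat t w - limit_stat| < kappa.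

Lemma mevent_close kappa n : mevent (close kappa n.+2).
Proof.
have mc : measurable_fun setT (close kappa n.+2).
  apply: measurable_fun_ltr => //; apply: measurableT_comp => //.
  by apply: measurable_funB => //; exact: measurable_stat.
have := mc measurableT [set true]; rewrite setTI; apply.
by [].
Qed.

Lemma cvg_mean_corr :
  arithmetic_mean (fun i => corr P (b i)) n @[n --> \oo] --> return_prob (1 - eps) d.
Proof.
apply: cesaro.
rewrite (_ : (fun i => _) = fun i => (1 - eps) *
    nbr_avg (hit (1 - eps) i.+1.*2.+1) (0 : 'rV[int]_d)); last first.
  by apply/funext => i; exact: corr_repeat_lattice.
have := cvg_return_prob delta_gt0 delta_lt1 d_gt0.
by rewrite -(cvg_shiftS (fun s => (1 - eps) * nbr_avg (hit (1 - eps) s.*2.+1) 0)).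
Qed.

(** If the statistic misses its limit by [kappa], then [2 * stat - 1] misses the return probability
    by [2 * kappa]. Once the mean correlation is within [kappa] of that limit, [spin_sum] is at
    least [kappa] times the number of terms in absolute value, and the linear variance bound gives a
    probability of order [1 / t]. *)
Lemma pr_not_close kappa : 0 < kappa ->
  pr (fun w => ~~ close kappa t w) @[t --> \oo] --> 0.
Proof.
move=> kappa_gt0; pose rho := (1 - eps) ^+ 2.
have rho01 : 0 < rho < 1.
  by rewrite /rho exprn_gt0 ?exprn_ilt1// ltW.
have decay i k : `|cov P b i (i.+2 + k)| <= 2 * rho ^+ k.
  by have := cov_repeat X eps01 u i.+1 k; rewrite exprM.
pose C := 2 * (2 / rho / (1 - rho)) + 2.
(* At [t = n.+3] the statistic has [n.+1] terms, and both [harmonic] and [arithmetic_mean] at index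
   [n] refer to [n.+1]. *)
pose bound t := C / kappa ^+ 2 * (harmonic (t - 3)%N : R).
apply: (@squeeze_cvgr _ _ _ _ (fun=> 0) bound); last 2 first.
- exact: cvg_cst.
- rewrite -[0](mulr0 (C / kappa ^+ 2)); apply: cvgMl_tmp.
  by rewrite (cvg_centern 3 (@harmonic R)); exact: cvg_harmonic.
have near_mean : \forall t \near \oo, `|return_prob (1 - eps) d -
    arithmetic_mean (fun i => corr P (b i)) (t - 3)%N| < kappa.
  have := cvg_mean_corr; rewrite -(cvg_centern 3).
  by move=> /cvgrPdist_lt; apply.
near=> t; rewrite pr_ge0 /=.
have t3 : (2 < t)%N by near: t; exists 3%N.
have tE : t = (t - 3).+1.+2 by lia.
have : `|return_prob (1 - eps) d -
    arithmetic_mean (fun i => corr P (b i)) (t - 3)%N| < kappa by near: t.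
rewrite /bound; move: (t - 3)%N tE => n -> nE.
have n_gt0 : 0 < n.+1%:R :> R by rewrite ltr0n.
have mz := mevent_neg (mevent_close kappa n.+1).
set z := fun w => ~~ close kappa n.+3 w.
rewrite /= ler_pdivlMr// ler_pdivlMr ?exprn_gt0// -(ler_pM2l n_gt0).
rewrite [leLHS](_ : _ = (kappa * n.+1%:R) ^+ 2 * pr z); last by ring.
apply: le_trans (sum_sum_cov_le mb rho01 decay n.+1).
apply: spin_chebyshev => // w; rewrite /z /close -leNgt repetition_statisticE => zw.
have spinE : spin_sum P b n.+1 w = n.+1%:R *
    (2 * (n.+1%:R^-1 * \sum_(i < n.+1) (b i w)%:R) - 1 -
     arithmetic_mean (fun i => corr P (b i)) n).
  rewrite /arithmetic_mean /= /series /= big_mkord /spin_sum !sumrB -mulr_sumr.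
  rewrite sumr_const card_ord; field.
  by rewrite ?nat1r ?natr1 pnatr_eq0.
rewrite -[leRHS]real_normK ?num_real// spinE normrM (gtr0_norm n_gt0) [kappa * _]mulrC.
rewrite ler_pXn2r ?nnegrE ?mulr_ge0 ?(ltW kappa_gt0)//. rewrite ler_pM2l//.
move: nE zw; rewrite /limit_stat.
set B := _ * \sum_(i < _) _; set M := arithmetic_mean _ _; set p := return_prob _ _.
rewrite ltr_norml => /andP[lo hi].
by rewrite ler_normr => /orP[|] ?; rewrite ler_normr; apply/orP; [left|right]; lra.
Unshelve. all: by end_near. Qed.

End Concentration.

(** * Separation of the limits in two different dimensions *)

Section Separation.
Context d0 (T : measurableType d0) (R : realType) (P : probability T R).

(** A union bound on the complements, valid for any coupling of the two models. *)
Lemma pr_and_ge (y z : T -> bool) : mevent y -> mevent z ->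
  1 - pr P (fun w => ~~ y w) - pr P (fun w => ~~ z w) <= pr P (fun w => y w && z w).
Proof.
move=> my mz; have := pr_split P my mz; rewrite pr_neg//.
have : pr P (fun w => y w && ~~ z w) <= pr P (fun w => ~~ z w).
  apply: pr_le => [||w /andP[]//]; last exact: mevent_neg.
  by apply: mevent_and => //; exact: mevent_neg.
by lra.
Qed.

End Separation.

Lemma return_prob_inj (R : realType) (delta : R) d1 d2 :
  0 < delta -> delta < 1 -> (0 < d1)%N -> (0 < d2)%N ->
  return_prob delta d1 = return_prob delta d2 -> d1 = d2.
Proof.
move=> delta_gt0 delta_lt1 d1_gt0 d2_gt0 rE.
have [d12|d21|//] := ltngtP d1 d2.
- by have := return_prob_decr delta_gt0 delta_lt1 d1_gt0 d12; rewrite rE ltxx.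
- by have := return_prob_decr delta_gt0 delta_lt1 d2_gt0 d21; rewrite rE ltxx.
Qed.

Theorem theorem1p3 (R : realType) (eps : R) (eps_gt0 : 0 < eps)
    (eps_lt1 : eps < 1) (d1 d2 : nat) (d1_gt0 : (0 < d1)%N)
    (d2_gt0 : (0 < d2)%N) (d1_neq_d2 : d1 <> d2)
    (u1 : lattice d1_gt0) (u2 : lattice d2_gt0) :
  distinguishable eps u1 u2 (@repetition_statistic R 2).
Proof.
pose q d := limit_stat eps d.
have q12 : q d1 != q d2.
  apply: contra_not_neq d1_neq_d2 => qE.
  apply: (@return_prob_inj R (1 - eps)) => //; first by rewrite subr_gt0.
    by rewrite ltrBlDr ltrDl.
  by move: qE; rewrite /q /limit_stat; lra.
(* Open intervals whose radius is half the distance of their centers are disjoint. *)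
pose kappa := `|q d1 - q d2| / 2.
have kappa_gt0 : 0 < kappa by rewrite divr_gt0// normr_gt0 subr_eq0.
exists (fun=> [set x | `|x - q d1| < kappa]), (fun=> [set x | `|x - q d2| < kappa]).
split=> [t|d T P X1 X2].
  apply/seteqP; split=> // x [/= x1 x2].
  have := ltrD x1 x2; rewrite -splitr distrC => /(le_lt_trans (ler_normD _ _)).
  by rewrite addrA subrK ltxx.
pose c1 := close X1 u1 kappa; pose c2 := close X2 u2 kappa.
have mc1 n : mevent (c1 n.+2) by exact: mevent_close.
have mc2 n : mevent (c2 n.+2) by exact: mevent_close.
have prJ n : P [set w | [set x | `|x - q d1| < kappa]
      (repetition_statistic R 2 (observations X1 u1 (t:=n) w)) /\
      [set x | `|x - q d2| < kappa]
      (repetition_statistic R 2 (observations X2 u2 (t:=n) w))] =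
    P [set w | c1 n w && c2 n w].
  by congr (P _); apply/seteqP; split=> w /= /andP.
rewrite (_ : (fun n => _) = fun n => P [set w | c1 n w && c2 n w]); last exact/funext.
have near2 : \forall n \near \oo, exists m, n = m.+2.
  by exists 2%N => // -[|[|m]]// _; exists m.
apply: cvg_EFin.
  near=> n; have [m ->] : exists m, n = m.+2 by near: n.
  by rewrite fin_num_measure//; exact: mevent_and.
(* The joint probability lies between the union bound, which tends to 1, and 1. *)
apply: (@squeeze_cvgr _ _ _ _
  (fun n => 1 - pr P (fun w => ~~ c1 n w) - pr P (fun w => ~~ c2 n w)) (fun=> 1)); last 2 first.
- rewrite -[X in _ --> X]subr0 -[X in _ --> X - _]subr0.
  apply: cvgB; first apply: cvgB; first exact: cvg_cst.
  + exact: pr_not_close.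
  + exact: pr_not_close.
- exact: cvg_cst.
near=> n; have [m ->] : exists m, n = m.+2 by near: n.
by rewrite pr_and_ge//=; apply: pr_le1; exact: mevent_and.
Unshelve. all: by end_near. Qed.
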